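(* Let $(V,g)$ be an inner product vector space over $k$, with $k=\mathbb{R}$ or $k=\mathbb{C}$ (possibly infinite-dimensional), and let $\varphi\in\operatorname{End}_k(V)$ be a finite potent endomorphism with $i(\varphi)\leq 1$. Then $$(\varphi^{(\#)})^{(\#)}=(\varphi^{(\#)})^{\dagger}.$$
   Context: An endomorphism $\varphi$ of $V$ is finite potent if $\varphi^n(V)$ is finite-dimensional for some $n$. Equivalently, there is a (unique) $\varphi$-invariant decomposition $V=W_\varphi\oplus U_\varphi$ (AST-decomposition) with $\varphi|_{U_\varphi}$ nilpotent, $W_\varphi$ finite-dimensional and $\varphi|_{W_\varphi}$ an automorphism of $W_\varphi$. The index $i(\varphi)$ is the nilpotency order of $\varphi|_{U_\varphi}$; $i(\varphi)\le 1$ iff $W_\varphi=\operatorname{Im}(\varphi)$ iff $U_\varphi=\operatorname{Ker}(\varphi)$. For $\varphi$ finite potent with $i(\varphi)\le 1$ one has $V=\operatorname{Im}(\varphi)\oplus[\operatorname{Im}(\varphi)]^{\perp}$, and the core inverse $\varphi^{(\#)}$ is the unique linear map with $\varphi\circ\varphi^{(\#)}=P_{\operatorname{Im}(\varphi)}$ (the orthogonal projection onto $\operatorname{Im}(\varphi)$ induced by this decomposition) and $\operatorname{Im}(\varphi^{(\#)})\subseteq\operatorname{Im}(\varphi)$. The map $\varphi^{(\#)}$ is again finite potent of index $\le1$, so it has a core inverse. A linear map $\theta\in\operatorname{End}_k(V)$ is admissible for the Moore-Penrose inverse if $V=\operatorname{Ker}(\theta)\oplus[\operatorname{Ker}(\theta)]^{\perp}$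 and $V=\operatorname{Im}(\theta)\oplus[\operatorname{Im}(\theta)]^{\perp}$ (this holds for $\theta=\varphi^{(\#)}$). In that case the Moore-Penrose inverse $\theta^\dagger$ is the unique linear map with $\theta\theta^\dagger\theta=\theta$, $\theta^\dagger\theta\theta^\dagger=\theta^\dagger$ and both $\theta^\dagger\theta$ and $\theta\theta^\dagger$ self-adjoint with respect to $g$. *)

(* Defs.v *)
From HB Require Import structures.
From mathcomp Require Import all_boot all_order all_algebra.
From mathcomp Require Import sesquilinear complex.
From mathcomp Require Import boolp classical_sets functions reals.

Set Implicit Arguments.
Unset Strict Implicit.
Unset Printing Implicit Defensive.

Import GRing.Theory.
Local Open Scope ring_scope.
Local Open Scope classical_set_scope.

Section LinearAlgebra.
Variables (K : fieldType) (V : lmodType K).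
Implicit Types (A B W U : set V) (phi : {linear V -> V}).

Definition subspace A : Prop :=
  A 0 /\ forall (a : K) (u v : V), A u -> A v -> A (a *: u + v).

Definition finite_dim A : Prop :=
  exists (n : nat) (e : 'I_n -> V),
    A = [set v | exists c : 'I_n -> K, v = \sum_(i < n) c i *: e i].

Definition is_direct_sum A B : Prop :=
  [/\ subspace A, subspace B,
      forall v, exists a b, [/\ A a, B b & v = a + b]
    & A `&` B = [set 0]].

Definition finite_potent phi : Prop :=
  exists n : nat, finite_dim (range (iter n phi)).

Definition is_AST_decomposition phi W U : Prop :=
  [/\ is_direct_sum W U,
      phi @` W `<=` W /\ phi @` U `<=` U,
      exists n : nat, forall u, U u -> iter n phi u = 0,
      finite_dim W
    & set_bij W W phi].

(* [n] is 0 exactly when U is trivial, so automorphisms have index 0. *)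
Definition is_nilpotency_order phi U (n : nat) : Prop :=
  (forall u, U u -> iter n phi u = 0) /\
  (forall m : nat, (forall u, U u -> iter m phi u = 0) -> (n <= m)%N).

(* The index i(phi); meaningful for finite potent [phi], which have exactly one
   AST-decomposition, and 0 otherwise. *)
Definition ast_index phi : nat :=
  xget 0%N [set n | exists W U,
    is_AST_decomposition phi W U /\ is_nilpotency_order phi U n].

(* The linear map satisfying [P], and the zero map if there is none. *)
Definition the_linear (P : {linear V -> V} -> Prop) : {linear V -> V} :=
  if pselect (exists psi, P psi) is left h then sval (cid h) else \0.

End LinearAlgebra.

Section InnerProduct.
Variables (K : numFieldType) (theta : K -> K) (V : lmodType K).
Variable g : {dot V for theta}.
Implicit Types (A : set V) (phi psi : {linear V -> V}).

Definition orthogonal_complement A : set V :=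
  [set v | forall a, A a -> g v a = 0].

(* The component of [v] in [A] along V = A (+) A^perp; only meaningful when
   this decomposition holds. *)
Definition orthogonal_projection A (v : V) : V :=
  xget 0 [set a | A a /\ orthogonal_complement A (v - a)].

Definition is_core_inverse phi psi : Prop :=
  [/\ finite_potent phi /\ (ast_index phi <= 1)%N,
      is_direct_sum (range phi) (orthogonal_complement (range phi)),
      phi \o psi =1 orthogonal_projection (range phi)
    & range psi `<=` range phi].

Definition core_inverse phi : {linear V -> V} := the_linear (is_core_inverse phi).

Definition kernel phi : set V := phi @^-1` [set 0].

Definition self_adjoint (f : V -> V) : Prop :=
  forall u v, g (f u) v = g u (f v).

Definition mp_admissible phi : Prop :=
  is_direct_sum (kernel phi) (orthogonal_complement (kernel phi)) /\
  is_direct_sum (range phi) (orthogonal_complement (range phi)).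

Definition is_mp_inverse phi psi : Prop :=
  [/\ mp_admissible phi,
      phi \o psi \o phi =1 phi,
      psi \o phi \o psi =1 psi,
      self_adjoint (psi \o phi)
    & self_adjoint (phi \o psi)].

Definition mp_inverse phi : {linear V -> V} := the_linear (is_mp_inverse phi).

End InnerProduct.

(* Main.v *)
(* By Fitting's argument, [phi] is finite potent of index at most 1 iff its range
   W is finite-dimensional and [phi] permutes W. Then the core inverse [psi] of
   [phi] is (phi restricted to W)^-1 composed with the orthogonal projection P
   onto W, so [psi] has range W and kernel the orthogonal complement of W, and
   it is again finite potent of index at most 1. Its core inverse [chi] satisfies
   psi chi = P = chi psi, which gives the Moore-Penrose equations. *)
Require Import Defs.
From HB Require Import structures.
From mathcomp Require Import all_boot all_order all_algebra.
From mathcomp Require Import sesquilinear complex.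
From mathcomp Require Import boolp classical_sets functions reals.

Import Order.TTheory GRing.Theory Num.Theory.
Local Open Scope ring_scope.
Local Open Scope classical_set_scope.

(** * Subspaces and finite spans *)

Section FiniteDimension.
Context {K : fieldType} {V : lmodType K}.
Implicit Types (A W U : set V) (phi : {linear V -> V}).

Definition lspan {n : nat} (e : 'I_n -> V) : set V :=
  [set v | exists c : 'I_n -> K, v = \sum_(i < n) c i *: e i].

Lemma lspan_subspace n (e : 'I_n -> V) : subspace (lspan e).
Proof.
split=> [|a _ _ [c ->] [d ->]].
  by exists (fun=> 0); rewrite big1 // => i _; rewrite scale0r.
exists (fun i => a * c i + d i); rewrite scaler_sumr -big_split /=.
by apply: eq_bigr => i _; rewrite scalerDl scalerA.
Qed.

Lemma mem_lspan n (e : 'I_n -> V) i : lspan e (e i).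
Proof.
exists (fun j => (j == i)%:R); rewrite (bigD1 i) //= eqxx scale1r.
by rewrite big1 ?addr0 // => j /negbTE->; rewrite scale0r.
Qed.

Lemma subspaceD A u v : subspace A -> A u -> A v -> A (u + v).
Proof. by move=> [_ H] Au Av; rewrite -[u]scale1r; exact: H. Qed.

Lemma subspaceZ A a u : subspace A -> A u -> A (a *: u).
Proof. by move=> [A0 H] Au; rewrite -[_ *: _]addr0; exact: H. Qed.

Lemma subspaceB A u v : subspace A -> A u -> A v -> A (u - v).
Proof.
by move=> hA Au Av; rewrite -scaleN1r; apply: subspaceD => //; exact: subspaceZ.
Qed.

Lemma subspace_range phi : subspace (range phi).
Proof.
split=> [|a _ _ [u _ <-] [v _ <-]]; first by exists 0 => //; rewrite linear0.
by exists (a *: u + v) => //; rewrite linearP.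
Qed.

(** Dividing the relation by [c j] expresses [e j] through the other vectors, so deleting it keeps
    the span. *)
Lemma lspan_dependent n (e : 'I_n.+1 -> V) (c : 'I_n.+1 -> K) j :
  \sum_i c i *: e i = 0 -> c j != 0 -> lspan e = lspan (e \o lift j).
Proof.
move=> ce0 cj0; have ej : e j = \sum_i (- (c j)^-1 * c (lift j i)) *: e (lift j i).
  apply: (scalerI cj0); move/eqP: ce0.
  rewrite (bigD1_ord j) //= addr_eq0 => /eqP->; rewrite scaler_sumr -sumrN.
  by apply: eq_bigr => i _; rewrite scalerA mulrA mulrN divff // mulN1r scaleNr.
apply/seteqP; split=> _ [d ->].
  exists (fun i => d j * (- (c j)^-1 * c (lift j i)) + d (lift j i)).
  rewrite (bigD1_ord j) //= {1}ej scaler_sumr -big_split /=.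
  by apply: eq_bigr => i _; rewrite scalerDl scalerA.
exists (fun i => if unlift j i is Some k then d k else 0).
rewrite (bigD1_ord j) //= unlift_none scale0r add0r.
by apply: eq_bigr => i _; rewrite liftK.
Qed.

(** * Iterates of a linear map and the Fitting decomposition *)

Lemma iter_linear_sum phi k n (c : 'I_n -> K) (e : 'I_n -> V) :
  iter k phi (\sum_i c i *: e i) = \sum_i c i *: iter k phi (e i).
Proof.
elim: k => //= k ->; rewrite linear_sum.
by apply: eq_bigr => i _; rewrite linearZ.
Qed.

Lemma iter_linearB phi k : {morph iter k phi : u v / u - v}.
Proof. by move=> u v; elim: k => //= k ->; rewrite linearB. Qed.

Lemma iter_linear0 phi k : iter k phi 0 = 0.
Proof. by elim: k => //= k ->; rewrite linear0. Qed.

(* A dependence between the images of a spanning family under some power of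
   [phi] yields a smaller spanning family of the range of a higher power; this
   can happen only finitely often. *)
Lemma finite_potent_free_range phi : finite_potent phi ->
  exists m n (e : 'I_n -> V), range (iter m phi) = lspan e /\
    forall k c, \sum_i c i *: iter k phi (e i) = 0 -> forall i, c i = 0.
Proof.
move=> [m [n [e]]]; elim: n m e => [|n IHn] m e he.
  by exists m, 0, e; split=> // k c _ [].
have [|/existsNP[k /existsNP[c /not_implyP[ce0 /existsNP[j /eqP cj0]]]]] :=
  pselect (forall k c, \sum_i c i *: iter k phi (e i) = 0 -> forall i, c i = 0).
  by exists m, n.+1, e.
apply: (IHn (k + m) ((iter k phi \o e) \o lift j)).
apply: etrans (lspan_dependent _ (iter k phi \o e) _ _ ce0 cj0).
apply/seteqP; split=> [_ [v _ <-]|_ [d ->]].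
  have : range (iter m phi) (iter m phi v) by exists v.
  by rewrite he iterD => -[d ->]; exists d; rewrite iter_linear_sum.
have : lspan e (\sum_i d i *: e i) by exists d.
rewrite /lspan -he => -[v _ hv]; exists v => //.
by rewrite iterD hv iter_linear_sum.
Qed.

(** Take W and U to be the range and the kernel of [iter m phi], with m such that a spanning family
    of W stays free under every power of [phi]. Then [phi] is injective on W, hence surjective by
    finite dimension. *)
Lemma Fitting_decomposition phi : finite_potent phi ->
  exists W U, is_AST_decomposition phi W U.
Proof.
move=> /finite_potent_free_range[m [n [e [he free_e]]]].
set W := range (iter m phi); set U := [set u | iter m phi u = 0].
have phiW w : W w -> W (phi w).
  by move=> [v _ <-]; exists (phi v) => //; rewrite -iterSr.
have inj0 k w : W w -> iter k phi w = 0 -> w = 0.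
  rewrite {1}/W he => -[c ->]; rewrite iter_linear_sum => /free_e c0.
  by rewrite big1 // => i _; rewrite c0 scale0r.
have surjW : W `<=` phi @` W.
  have /choice[M hM] i : exists c : 'I_n -> K, phi (e i) = \sum_j c j *: e j.
    have : W (phi (e i)) by apply: phiW; rewrite /W he; exact: mem_lspan.
    by rewrite {1}/W he.
  (* [P] is the matrix of [phi] on W, row i holding the coordinates of [phi (e i)]. Freeness of
     these images makes its rows independent, so w has a preimage whose coordinates are those of w
     times the inverse of [P]. *)
  pose P := \matrix_(i, j) M i j.
  have Punit : P \in unitmx.
    rewrite -row_free_unit; apply/inj_row_free => u uP0; apply/rowP => i.
    rewrite mxE; apply: (free_e 1%N (u 0)) => /=.
    under eq_bigr do rewrite hM scaler_sumr.
    rewrite exchange_big big1 //= => j _.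
    under eq_bigr do rewrite scalerA.
    rewrite -scaler_suml; move/rowP/(_ j): uP0; rewrite !mxE.
    by under eq_bigr do rewrite mxE; move=> ->; rewrite scale0r.
  move=> w Ww; move: (Ww); rewrite {1}/W he => -[c wE].
  pose d := \row_i c i *m invmx P.
  have dP : d *m P = \row_i c i by rewrite mulmxKV.
  exists (\sum_i d 0 i *: e i); first by rewrite /W he; exists (d 0).
  rewrite linear_sum wE.
  under eq_bigr do rewrite linearZ hM /= scaler_sumr.
  rewrite exchange_big; apply: eq_bigr => j _ /=.
  under eq_bigr do rewrite scalerA.
  rewrite -scaler_suml; congr (_ *: _).
  move/rowP/(_ j): dP; rewrite !mxE => <-.
  by apply: eq_bigr => i _; rewrite [P _ _]mxE.
have surj_iter k w : W w -> exists2 w', W w' & iter k phi w' = w.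
  elim: k w => [|k IHk] w; first by exists w.
  by move=> /surjW[w1 /IHk[w2 Ww2 <-] <-]; exists w2.
have subW : subspace W by rewrite /W he; exact: lspan_subspace.
exists W, U; split; last split.
- split=> //.
  + split=> [|a u v]; rewrite /U /=; first exact: iter_linear0.
    have -> : iter m phi (a *: u + v) = a *: iter m phi u + iter m phi v.
      by elim: {+}m => //= k ->; rewrite linearP.
    by move=> -> ->; rewrite scaler0 addr0.
  (* The W-component of v is an element of W with the same image as v under [iter m phi]. *)
  + move=> v; have [|w Ww hw] := surj_iter m (iter m phi v); first by exists v.
    exists w, (v - w); split=> //; last by rewrite addrC subrK.
    by rewrite /U /= iter_linearB hw subrr.
  + apply/seteqP; split=> [w [Ww]|_ ->]; first exact: inj0.
    by split; [exact: subW.1|exact: iter_linear0].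
- split; first by move=> _ [w /phiW Ww <-].
  by move=> _ [u Uu <-]; rewrite /U /= -iterSr /= Uu linear0.
- by exists m.
- by exists n, e.
- by move=> w /phiW.
- move=> u v; rewrite !inE => Wu Wv /eqP.
  rewrite -subr_eq0 -linearB => /eqP uv0; apply/eqP; rewrite -subr_eq0.
  by apply/eqP/(inj0 1%N); first exact: subspaceB.
- exact: surjW.
Qed.

(** * Endomorphisms of index at most one *)

Lemma set_bij_eq0 W phi w : set_bij W W phi -> W 0 -> W w -> phi w = 0 -> w = 0.
Proof.
by case=> _ inj _ W0 Ww pw0; apply: inj; rewrite ?inE // pw0 linear0.
Qed.

(** If the index is at most 1, [phi] kills U, so its range is the image of W, which is W.
    Conversely, if [phi] is injective on its range, every vector killed by some power of [phi] is
    already killed by [phi]. *)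
Lemma finite_potent_index_le1P phi :
  finite_potent phi /\ (ast_index phi <= 1)%N <->
  finite_dim (range phi) /\ set_bij (range phi) (range phi) phi.
Proof.
split=> [[fp]|[fd bij]].
- rewrite /ast_index; case: xgetP => [n _ [W [U [ast [nilU _]]]]|]; last first.
    (* The default value 0 of [ast_index] would meet the bound vacuously. It is ruled out because
       the Fitting decomposition has a least nilpotency exponent. *)
    move=> no_order _; have [W [U ast]] := Fitting_decomposition phi fp.
    have [_ _ [N hN] _ _] := ast.
    have exN : exists n, `[< forall u, U u -> iter n phi u = 0 >].
      by exists N; exact/asboolP.
    case: (ex_minnP exN) => n /asboolP nilU minU; case: (no_order n).
    by exists W, U; split=> //; split=> // k hk; apply: minU; exact/asboolP.
  move=> n_le1; have [[subW subU decomp _] [phiW _] _ fdW bijW] := ast.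
  have phiU u : U u -> phi u = 0.
    by case: n n_le1 nilU => [|[|//]] _ nilU /nilU //= ->; rewrite linear0.
  suff <- : W = range phi by [].
  apply/seteqP; split; first by case: bijW => _ _ surjW w /surjW[v _ <-]; exists v.
  move=> _ [v _ <-]; have [w [u [Ww Uu ->]]] := decomp v.
  by rewrite linearD (phiU u) // addr0; apply: phiW; exists w.
- split; first by exists 1%N.
  rewrite /ast_index; case: xgetP => // n _ [W [U [[_ _ [N hN] _ _] [_]]]].
  apply=> u Uu /=; have R0 := (subspace_range phi).1.
  (* Injectivity on the range lowers the exponent one step at a time, down to 1. *)
  elim: N {hN} (hN u Uu) => [/= -> |N IHN]; first by rewrite linear0.
  case: N IHN => [|N IHN] // hSSN; apply: IHN => /=.
  apply: (set_bij_eq0 _ _ _ bij R0) hSSN.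
  by exists (iter N phi u).
Qed.

Lemma the_linearP (P : {linear V -> V} -> Prop) :
  (exists psi, P psi) -> P (the_linear P).
Proof. by move=> h; rewrite /the_linear; case: pselect => // h'; exact: svalP. Qed.

Lemma linear_bundle (f : V -> V) : linear f -> exists psi : {linear V -> V}, psi =1 f.
Proof.
move=> fl; pose F : {linear V -> V} := HB.pack f (GRing.isLinear.Build K V V _ f fl).
by exists F.
Qed.

End FiniteDimension.

(** * Inner products and orthogonal projections *)

Section InnerProduct.
Context {K : numFieldType} {theta : K -> K} {V : lmodType K}.
Variable g : {dot V for theta}.
Implicit Types (A : set V) (phi psi chi : {linear V -> V}).

Lemma dot0l v : g 0 v = 0. Proof. exact: linear0l. Qed.
Lemma dot0r v : g v 0 = 0. Proof. exact: linear0r. Qed.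
Lemma dotDl w u v : g (u + v) w = g u w + g v w. Proof. exact: linearDl. Qed.
Lemma dotDr w u v : g w (u + v) = g w u + g w v. Proof. exact: linearDr. Qed.
Lemma dotBl w u v : g (u - v) w = g u w - g v w. Proof. exact: linearBl. Qed.
Lemma dotZl w a u : g (a *: u) w = a * g u w. Proof. exact: linearZl_LR. Qed.
Lemma dotZr w a u : g w (a *: u) = theta a * g w u. Proof. exact: linearZr_LR. Qed.

Lemma dotPl w a u v : g (a *: u + v) w = a * g u w + g v w.
Proof. by rewrite dotDl dotZl. Qed.

Lemma dotPr w a u v : g w (a *: u + v) = theta a * g w u + g w v.
Proof. by rewrite dotDr dotZr. Qed.

Lemma dotC u v : g u v = theta (g v u).
Proof. by rewrite [LHS]hermitian_subproof expr0 mul1r. Qed.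

Lemma dot_eq0C u v : g u v = 0 -> g v u = 0.
Proof.
(* [theta] is only a function here; that it fixes 0 is read off from Hermitian symmetry at the zero
   vector. *)
move=> uv0; have := dotC 0 0; rewrite dot0l => theta0.
by rewrite dotC uv0 -theta0.
Qed.

Lemma dot_self_eq0 u : g u u = 0 -> u = 0.
Proof.
move=> u0; apply/eqP; apply: contraT => /(@neq0_dnorm_gt0 _ _ _ g).
by rewrite u0 ltxx.
Qed.

Lemma dot_injl u v : (forall w, g u w = g v w) -> u = v.
Proof.
move=> uv; apply/eqP; rewrite -subr_eq0; apply/eqP/dot_self_eq0.
by rewrite dotBl uv subrr.
Qed.

Lemma subspace_orthogonal_complement A : subspace (orthogonal_complement g A).
Proof.
split=> [a _|a u v uA vA w Aw]; first by rewrite dot0l.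
by rewrite dotPl uA // vA // mulr0 addr0.
Qed.

Lemma orthogonal_complement_disjoint A u :
  A u -> orthogonal_complement g A u -> u = 0.
Proof. by move=> Au /(_ u Au) /dot_self_eq0. Qed.

Lemma orthogonal_decomp_unique A v a b : subspace A ->
  A a -> orthogonal_complement g A (v - a) ->
  A b -> orthogonal_complement g A (v - b) -> a = b.
Proof.
move=> hA Aa va Ab vb; apply/eqP; rewrite -subr_eq0; apply/eqP.
apply: (orthogonal_complement_disjoint A); first exact: subspaceB.
have -> : a - b = (v - b) - (v - a) by rewrite opprB [RHS]addrC addrA subrK.
exact: subspaceB (subspace_orthogonal_complement A) vb va.
Qed.

Lemma orthogonal_projectionE A v a : subspace A ->
  A a -> orthogonal_complement g A (v - a) -> orthogonal_projection g A v = a.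
Proof.
move=> hA Aa va; apply: xget_unique => // b [Ab vb].
exact: (orthogonal_decomp_unique _ _ _ _ hA Ab vb Aa va).
Qed.

(** Gram-Schmidt, by induction on the number of spanning vectors: the first vector is replaced by
    its component [f] orthogonal to the span of the others, and the projections of [v] onto that
    span and onto [f] are added. *)
Lemma finite_dim_orthogonal_decomp A v : finite_dim A ->
  exists a, A a /\ orthogonal_complement g A (v - a).
Proof.
move=> [n [e ->]]; elim: n e v => [|n IHn] e v.
  by exists 0; split=> [|_ [c ->]]; rewrite ?big_ord0 ?dot0r //; exists (fun=> 0); rewrite big_ord0.
pose B := lspan (e \o lift ord0); have [p [Bp pP]] := IHn (e \o lift ord0) (e ord0).
have subB : subspace B by exact: lspan_subspace.
have inE' (u : V) (t : K) : B u -> lspan e (t *: e ord0 + u).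
  move=> [c ->]; exists (fun i => if unlift ord0 i is Some k then c k else t).
  rewrite (bigD1_ord ord0) //= unlift_none; congr (_ + _).
  by apply: eq_bigr => i _; rewrite liftK.
have lspanE u : lspan e u -> exists t b, B b /\ u = t *: (e ord0 - p) + b.
  move=> [c ->]; exists (c ord0), (c ord0 *: p + \sum_(i < n) c (lift ord0 i) *: e (lift ord0 i)).
  split; first by apply: subB.2 => //; exists (fun i => c (lift ord0 i)).
  by rewrite (bigD1_ord ord0) //= addrA scalerBr subrK.
have [q [Bq qP]] := IHn (e \o lift ord0) v.
set f := e ord0 - p in pP lspanE.
exists ((g v f / g f f) *: f + q); split.
  rewrite /f scalerBr -addrA; apply: inE'; apply: subspaceD => //.
  by rewrite -scalerN -scaleN1r; do 2!apply: subspaceZ => //.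
move=> _ /lspanE[t [b [Bb ->]]].
have fb : g f b = 0 by apply: pP.
have vqb : g (v - q) b = 0 by apply: qP.
have qf : g q f = 0 by apply: dot_eq0C; exact: pP.
have key : g (v - (g v f / g f f *: f + q)) f = 0.
  rewrite dotBl dotPl qf addr0.
  (* The spanning family may be dependent, so [f] can be 0; the pairing with [f] then vanishes
     whatever the quotient is. *)
  have [ff0|ff0] := eqVneq (g f f) 0; last by rewrite divfK // subrr.
  by rewrite (dot_self_eq0 _ ff0) !dot0r mulr0 subrr.
rewrite dotPr key mulr0 add0r.
by rewrite [_ + q]addrC opprD addrA dotBl vqb dotZl fb mulr0 subrr.
Qed.

Lemma orthogonal_direct_sum A : subspace A ->
  (forall v, exists a, A a /\ orthogonal_complement g A (v - a)) ->
  is_direct_sum A (orthogonal_complement g A).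
Proof.
move=> hA dec; split=> //; first exact: subspace_orthogonal_complement.
  by move=> v; have [a [Aa va]] := dec v; exists a, (v - a); split; rewrite // [RHS]addrC subrK.
apply/seteqP; split=> [u [Au]|_ ->]; first exact: orthogonal_complement_disjoint.
by split; [exact: hA.1|exact: (subspace_orthogonal_complement A).1].
Qed.

(** * Core inverses and Moore-Penrose inverses *)

(** Existence: send v to the preimage in W of its orthogonal projection onto W. Linearity follows
    from injectivity of [phi] on W and uniqueness of the projection. *)
Lemma core_inverseP phi : finite_potent phi -> (ast_index phi <= 1)%N ->
  is_core_inverse g phi (core_inverse g phi).
Proof.
move=> fp le1; have [fd bij] := (finite_potent_index_le1P phi).1 (conj fp le1).
apply: the_linearP; pose W := range phi; have subW : subspace W by exact: subspace_range.
have dec v := finite_dim_orthogonal_decomp W v fd.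
have /choice[f hf] v : exists w, W w /\ orthogonal_complement g W (v - phi w).
  have [a [Wa va]] := dec v; have [_ _ /(_ a Wa)[w Ww wa]] := bij.
  by exists w; rewrite wa.
have flin : linear f.
  move=> a u v; have [_ inj _] := bij; have [Wu uP] := hf u; have [Wv vP] := hf v.
  apply: inj; rewrite ?inE; [exact: (hf _).1|exact: subW.2|].
  apply: (orthogonal_decomp_unique W (a *: u + v)) => //; try by eexists.
    exact: (hf _).2.
  rewrite linearP opprD addrACA -scalerBr.
  exact: (subspace_orthogonal_complement W).2.
have [psi psiE] := linear_bundle f flin.
exists psi; split=> //.
- exact: orthogonal_direct_sum.
- move=> v /=; rewrite psiE; apply/esym/orthogonal_projectionE => //.
  exact: (hf v).2.
- by move=> _ [v _ <-]; rewrite psiE; exact: (hf v).1.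
Qed.

Lemma mp_inverse_unique phi psi chi :
  is_mp_inverse g phi psi -> is_mp_inverse g phi chi -> psi =1 chi.
Proof.
move=> [_ psi1 psi2 psi3 psi4] [_ chi1 chi2 chi3 chi4] v.
rewrite /self_adjoint /eqfun /= in psi1 psi2 psi3 psi4 chi1 chi2 chi3 chi4.
have range_eq u : phi (psi u) = phi (chi u).
  (* Both products are self-adjoint, and each fixes the range of [phi]; moving them across [g] turns
     one into the other. *)
  by apply: dot_injl => w; rewrite psi4 -(chi1 (psi w)) -chi4 -psi4 psi1.
have kernel_eq u : psi (phi u) = chi (phi u).
  by apply: dot_injl => w; rewrite psi3 -(chi1 w) -psi3 -chi3 psi1.
by rewrite -psi2 range_eq kernel_eq chi2.
Qed.

(** Replaces the chosen value [orthogonal_projection] by the two conditions that characterize it. *)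
Lemma is_core_inverse_range phi psi v : is_core_inverse g phi psi ->
  [/\ range phi (psi v), range phi (phi (psi v)) &
    orthogonal_complement g (range phi) (v - phi (psi v))].
Proof.
move=> [_ [subW _ dec _] psiE ran]; split; [by apply: ran; exists v|by eexists|].
have [a [b [Wa Wb ->]]] := dec v.
have aP : orthogonal_complement g (range phi) (a + b - a) by rewrite addrC addKr.
by have /= -> := psiE (a + b); rewrite (orthogonal_projectionE _ _ _ subW Wa aP).
Qed.

Lemma is_core_inverse_structure phi psi : is_core_inverse g phi psi ->
  [/\ finite_potent psi, (ast_index psi <= 1)%N, range psi = range phi &
    kernel psi = orthogonal_complement g (range phi)].
Proof.
move=> psiP; have [fp1 [subW _ _ _] _ ran] := psiP.
have [fd bij] := (finite_potent_index_le1P phi).1 fp1.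
have W0 := subW.1; have struct v := is_core_inverse_range phi psi v psiP.
(* The projection onto W fixes [phi w], so [phi] takes the same value at [psi (phi w)] and at w,
   both in W. *)
have psiK w : range phi w -> psi (phi w) = w.
  move=> Ww; have [W1 W2 W3] := struct (phi w); have [_ inj _] := bij.
  apply: inj; rewrite ?inE //; apply/eqP; rewrite -subr_eq0 -opprB oppr_eq0.
  apply/eqP/(orthogonal_complement_disjoint (range phi)) => //.
  by apply: subspaceB => //; exists w.
have rangeE : range psi = range phi.
  by apply/seteqP; split=> // w Ww; exists (phi w) => //; exact: psiK.
have kerE : kernel psi = orthogonal_complement g (range phi).
  apply/seteqP; split=> v; rewrite /kernel /=.
    by move=> v0; have [_ _] := struct v; rewrite v0 linear0 subr0.
  move=> vP; have [W1 W2 W3] := struct v.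
  apply: (set_bij_eq0 _ _ _ bij W0 W1); apply: (orthogonal_complement_disjoint (range phi)) => //.
  rewrite -[phi (psi v)](subKr v).
  exact: subspaceB (subspace_orthogonal_complement _) vP W3.
suff [] : finite_potent psi /\ (ast_index psi <= 1)%N by split.
apply/finite_potent_index_le1P; rewrite rangeE; split=> //; split.
- by move=> w _; apply: ran; exists w.
- move=> u v; rewrite !inE => Wu Wv /eqP; rewrite -subr_eq0 -linearB => /eqP uv0.
  apply/eqP; rewrite -subr_eq0; apply/eqP/(orthogonal_complement_disjoint (range phi)).
    exact: subspaceB.
  by rewrite -kerE.
- by move=> w Ww; exists (phi w); [exists w|exact: psiK].
Qed.

(** Both products of [psi] and [chi] are the orthogonal projection onto W, hence self-adjoint. The
    residuals lie in the kernels of [psi] and [chi], which yields the other two equations. *)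
Lemma core_inverse_is_mp phi psi chi :
  is_core_inverse g phi psi -> is_core_inverse g psi chi -> is_mp_inverse g psi chi.
Proof.
move=> psiP chiP; have [fp le1 ranE kerE] := is_core_inverse_structure _ _ psiP.
have [_ _ _ kerE'] := is_core_inverse_structure _ _ chiP.
have [_ [subW _ dec _] _ _] := psiP.
set W := range phi in ranE kerE subW dec.
set Wp := orthogonal_complement g W in kerE dec.
have struct v := is_core_inverse_range psi chi v chiP.
rewrite ranE in struct kerE'.
(* Both sides reduce to [g (f u) (f v)]. *)
have proj_self f : (forall v, W (f v)) -> (forall v, Wp (v - f v)) -> self_adjoint g f.
  move=> fW fWp u v; rewrite -[v in LHS](subrK (f v)) -[u in RHS](subrK (f u)).
  by rewrite dotDr dotDl (fWp u) // add0r (dot_eq0C _ _ (fWp v _ (fW u))) add0r.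
have chi_psi v : W (chi (psi v)) /\ Wp (v - chi (psi v)).
  have [W1 W2 W3] := struct (psi v); split=> //.
  rewrite -kerE /kernel /= linearB.
  apply: (orthogonal_complement_disjoint W) => //; apply: subspaceB => //.
  by rewrite -ranE; exists v.
(* The [Wp]-component of a vector orthogonal to [Wp] is orthogonal to itself, hence 0. *)
have WWp : orthogonal_complement g Wp = W.
  apply/seteqP; split=> v vP; last by move=> u /(_ v vP) /dot_eq0C.
  have [a [b [Wa Wb vE]]] := dec v; rewrite vE in vP *.
  have := vP b Wb; rewrite dotDl (dot_eq0C _ _ (Wb a Wa)) add0r.
  by move=> /dot_self_eq0 ->; rewrite addr0.
have dW : is_direct_sum W Wp.
  by apply: orthogonal_direct_sum => // v; exists (chi (psi v)).
split.
- split; rewrite ?ranE //; rewrite kerE WWp; move: dW => [h1 h2 h3 h4].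
  split=> //; last by rewrite setIC.
  by move=> v; have [a [b [Wa Wb ->]]] := h3 v; exists b, a; rewrite addrC.
- move=> v /=; have [_ ] := chi_psi v; rewrite -kerE /kernel /= linearB.
  by move=> /eqP; rewrite subr_eq0 => /eqP.
- move=> v /=; have [_ _ ] := struct v; rewrite -kerE' /kernel /= linearB.
  by move=> /eqP; rewrite subr_eq0 => /eqP.
- by apply: proj_self => v; have [] := chi_psi v.
- by apply: proj_self => v; have [] := struct v.
Qed.

(** The iterated core inverse satisfies the Moore-Penrose conditions, so [mp_inverse] does too, and
    uniqueness identifies them. Keeping [theta] general covers the real and complex cases at
    once. *)
Lemma core_inverse_core_inverse phi : finite_potent phi -> (ast_index phi <= 1)%N ->
  core_inverse g (core_inverse g phi) =1 mp_inverse g (core_inverse g phi).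
Proof.
move=> fp le1; have psiP := core_inverseP phi fp le1.
have [fp' le1' _ _] := is_core_inverse_structure _ _ psiP.
have mpP := core_inverse_is_mp _ _ _ psiP (core_inverseP _ fp' le1').
by apply: (mp_inverse_unique _ _ _ mpP); apply: the_linearP; eexists; exact: mpP.
Qed.

End InnerProduct.

Theorem corollary4p8 (R : realType) :
  (forall (V : lmodType R) (g : {dot V for (@idfun R)}) (phi : {linear V -> V}),
     finite_potent phi -> (ast_index phi <= 1)%N ->
     core_inverse g (core_inverse g phi) =1 mp_inverse g (core_inverse g phi))
  /\
  (forall (V : lmodType R[i]) (g : {dot V for (@Num.conj R[i])})
          (phi : {linear V -> V}),
     finite_potent phi -> (ast_index phi <= 1)%N ->
     core_inverse g (core_inverse g phi) =1 mp_inverse g (core_inverse g phi)).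
Proof. by split=> V g phi; exact: core_inverse_core_inverse. Qed.
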